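(* Let $\Omega\subset\mathbb R^2$ be open, bounded and connected, let $L>0$, and let $F\colon\mathcal A(\Omega)\to[0,+\infty]$ be a set function that is (i) lower semicontinuous with respect to the Hausdorff convergence of open sets, and (ii) monotone with respect to set inclusion. Then the problem $$\min\{F(\Omega\setminus\Sigma):\ \Sigma\subset\overline\Omega \text{ closed, connected, and } \mathcal H^1(\Sigma)=L\}$$ admits a minimizer, i.e. there is a closed connected set $\Sigma\subset\overline\Omega$ with $\mathcal H^1(\Sigma)=L$ such that $F(\Omega\setminus\Sigma)\le F(\Omega\setminus\Sigma_1)$ for every closed connected $\Sigma_1\subset\overline\Omega$ with $\mathcal H^1(\Sigma_1)=L$.
   Context: $\mathcal H^1$ is the 1-dimensional Hausdorff measure. $\mathcal A(\Omega)$ denotes the class of open subsets of $\Omega$. For nonempty closed sets $\Sigma_1,\Sigma_2\subset\overline\Omega$ the Hausdorff distance is $\mathrm d_H(\Sigma_1,\Sigma_2)=\max\{\max_{x\in\Sigma_1}\mathrm d(x,\Sigma_2),\max_{x\in\Sigma_2}\mathrm d(x,\Sigma_1)\}$, where $\mathrm d(x,\Sigma)=\min_{y\in\Sigma}|x-y|$. A sequence $\{A_n\}$ in $\mathcal A(\Omega)$ is Hausdorff converging in $\mathcal A(\Omega)$ to $A\in\mathcal A(\Omega)$ if $\mathrm d_H(\overline\Omega\setminus A_n,\overline\Omega\setminus A)\to0$. $F$ is lower semicontinuous if $\liminf_{n\to\infty}F(A_n)\ge F(A)$ whenever $\{A_n\}$ is Hausdorff converging in $\mathcal A(\Omega)$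 to $A$. $F$ is monotone if $F(A_1)\le F(A_2)$ whenever $A_1,A_2\in\mathcal A(\Omega)$ with $A_1\subset A_2$. *)

(* Defs.v *)
From HB Require Import structures.
From mathcomp Require Import all_boot all_order all_algebra.
From mathcomp Require Import all_classical all_reals all_analysis.

Set Implicit Arguments.
Unset Strict Implicit.
Unset Printing Implicit Defensive.

Import Order.TTheory GRing.Theory Num.Theory.
Import numFieldNormedType.Exports.

Local Open Scope classical_set_scope.
Local Open Scope ring_scope.

(* The canonical norm of 'rV[R]_2 is the sup norm: it induces the usual
   topology and bounded sets, but all metric quantities below (diameters,
   Hausdorff measure, Hausdorff distance) must use the Euclidean distance. *)
Definition eucl_dist {R : realType} (x y : 'rV[R]_2) : R :=
  Num.sqrt (\sum_(i < 2) (x 0 i - y 0 i) ^+ 2).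

(* The maximum with 0 only matters for the empty set, whose supremum of
   distances is -oo and whose diameter is 0 by convention. *)
Definition diam {R : realType} (U : set 'rV[R]_2) : \bar R :=
  maxe 0%E (ereal_sup [set (eucl_dist p.1 p.2)%:E | p in U `*` U]).

Definition hausdorff1_delta {R : realType} (delta : R) (E : set 'rV[R]_2) :
    \bar R :=
  ereal_inf [set (\sum_(0 <= k <oo) diam (U k))%E |
    U in [set U : nat -> set 'rV[R]_2 |
      E `<=` \bigcup_k U k /\ forall k, (diam (U k) <= delta%:E)%E]].

(* In dimension 1 the usual normalizing constant of the Hausdorff measure,
   omega_s / 2 ^ s, equals 1. *)
Definition hausdorff1 {R : realType} (E : set 'rV[R]_2) : \bar R :=
  ereal_sup [set hausdorff1_delta delta E | delta in [set d : R | 0 < d]].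

(* Suprema and infima are taken in the extended reals; for nonempty compact
   sets they are attained and finite. *)
Definition dist_to_set {R : realType} (x : 'rV[R]_2) (S : set 'rV[R]_2) :
    \bar R :=
  ereal_inf [set (eucl_dist x y)%:E | y in S].

Definition hausdorff_dist {R : realType} (S1 S2 : set 'rV[R]_2) : \bar R :=
  maxe (ereal_sup [set dist_to_set x S2 | x in S1])
       (ereal_sup [set dist_to_set x S1 | x in S2]).

Definition open_subsets {R : realType} (Omega : set 'rV[R]_2) :
    set (set 'rV[R]_2) :=
  [set A | open A /\ A `<=` Omega].

Definition hausdorff_converging {R : realType} (Omega : set 'rV[R]_2)
    (A_ : nat -> set 'rV[R]_2) (A : set 'rV[R]_2) : Prop :=
  hausdorff_dist (closure Omega `\` A_ n) (closure Omega `\` A)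
    @[n --> \oo] --> 0%E.

(* Set functions on [open_subsets Omega] are represented by functions on all
   subsets of the plane, whose values outside of [open_subsets Omega] are
   never constrained nor used. *)
Definition hausdorff_lsc {R : realType} (Omega : set 'rV[R]_2)
    (F : set 'rV[R]_2 -> \bar R) : Prop :=
  forall (A_ : nat -> set 'rV[R]_2) (A : set 'rV[R]_2),
    (forall n, open_subsets Omega (A_ n)) -> open_subsets Omega A ->
    hausdorff_converging Omega A_ A ->
    (F A <= limn_einf (fun n => F (A_ n)))%E.

Definition set_monotone {R : realType} (Omega : set 'rV[R]_2)
    (F : set 'rV[R]_2 -> \bar R) : Prop :=
  forall A1 A2 : set 'rV[R]_2,
    open_subsets Omega A1 -> open_subsets Omega A2 -> A1 `<=` A2 ->
    (F A1 <= F A2)%E.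

Definition admissible {R : realType} (Omega : set 'rV[R]_2) (L : R)
    (S : set 'rV[R]_2) : Prop :=
  [/\ S `<=` closure Omega, closed S, connected S & hausdorff1 S = L%:E].

(* Main.v *)
Require Import Defs.
From mathcomp Require Import all_boot all_order all_algebra.
From mathcomp Require Import all_classical all_reals all_analysis.
From mathcomp Require Import finmap ring lra zify.
Import Order.TTheory GRing.Theory Num.Theory.
Import numFieldNormedType.Exports.
Local Open Scope classical_set_scope.
Local Open Scope ring_scope.

Set Implicit Arguments.
Unset Strict Implicit.
Unset Printing Implicit Defensive.

(** The proof is the direct method.  Since [closure Omega] is compact, a
    minimizing sequence has a subsequence converging in the Hausdorff distance
    to some closed [E] ([blaschke_selection]); connectedness passes to the limit
    ([connected_of_approx]) and length can only drop ([golab_hausdorff1_le]).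
    The complements converge as well, so lower semicontinuity makes
    [F (Omega `\` E)] at most the infimum.  There remains to bring the length of
    [E] back to [L], which monotonicity allows as long as [E] only grows.  If [E]
    contains a point [x] of [Omega], a star of many short spokes centred at [x]
    is attached to [E]: the total length depends continuously on the radius of
    the star, and is at least [L] for the full radius when there are enough spokes,
    so that some radius gives exactly [L] ([enlarge_to_length]).  If [E] misses
    [Omega], then [Omega `\` E] is all of [Omega], where [F] is largest, and
    every admissible set is a minimizer; one is obtained by enlarging a point.

    The heart of the matter is the semicontinuity of length along continua
    (Golab's theorem).  A cover of the approximating sets turns into a cover of
    the limit by thickening each of its members by a small [rho], at a cost of
    [2 * rho] per member; this is harmless as soon as the number of members is
    bounded independently of the approximating set.  Such a bound holds for
    continua ([connected_uniform_cover]): take a cover by tiny open sets, of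
    total diameter close to the length.  By connectedness these can be listed so
    that each of them meets an earlier one ([connected_linked_cover]), that is,
    they form a tree.  Going from the leaves to the root, one gathers them into
    clusters of diameter comparable to the scale [d] ([cluster_merge]).  As the
    diameter of a union of two intersecting sets is at most the sum of the
    diameters, the total diameter increases only by one tiny set per cluster,
    while each cluster consumes an amount about [d] of the total, so their
    number is of the order of [L / d]. *)

(** * The Euclidean distance on the plane *)

Section EuclideanPlane.
Variable R : realType.
Implicit Types (x y z : 'rV[R]_2) (U V E : set 'rV[R]_2).

Lemma eucl_distE x y :
  eucl_dist x y = Num.sqrt ((x 0 0 - y 0 0) ^+ 2 + (x 0 1 - y 0 1) ^+ 2).
Proof.
rewrite /eucl_dist big_ord_recr big_ord1 /=.
have -> : widen_ord (leqnSn 1) ord0 = 0 :> 'I_2 by apply: val_inj.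
by have -> : ord_max = 1 :> 'I_2 by apply: val_inj.
Qed.

Lemma eucl_dist_ge0 x y : 0 <= eucl_dist x y.
Proof. exact: sqrtr_ge0. Qed.

Lemma eucl_distC x y : eucl_dist x y = eucl_dist y x.
Proof. by rewrite !eucl_distE; congr Num.sqrt; ring. Qed.

Lemma eucl_distxx x : eucl_dist x x = 0.
Proof. by rewrite eucl_distE !subrr expr0n addr0 sqrtr0. Qed.

Lemma eucl_dist_sqr x y :
  eucl_dist x y ^+ 2 = (x 0 0 - y 0 0) ^+ 2 + (x 0 1 - y 0 1) ^+ 2.
Proof. by rewrite eucl_distE sqr_sqrtr// addr_ge0// sqr_ge0. Qed.

Lemma eucl_distD z x y : eucl_dist x y <= eucl_dist x z + eucl_dist z y.
Proof.
have p0 := eucl_dist_ge0 x z; have q0 := eucl_dist_ge0 z y.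
have := eucl_dist_sqr x z; have := eucl_dist_sqr z y.
have := eucl_dist_sqr x y.
set p := eucl_dist x z in p0 *; set q := eucl_dist z y in q0 *.
set d := eucl_dist x y.
set a := x 0 0 - z 0 0; set b := x 0 1 - z 0 1.
set c := z 0 0 - y 0 0; set e := z 0 1 - y 0 1.
have -> : x 0 0 - y 0 0 = a + c by rewrite /a /c; ring.
have -> : x 0 1 - y 0 1 = b + e by rewrite /b /e; ring.
move=> dE qE pE.
(* the Cauchy-Schwarz inequality *)
have cs : a * c + b * e <= p * q.
  apply: le_trans (ler_norm _) _.
  rewrite -(@ler_pXn2r _ 2) ?nnegrE ?mulr_ge0//.
  rewrite real_normK ?num_real// exprMn pE qE.
  have := sqr_ge0 (a * e - b * c); nra.
rewrite -(@ler_pXn2r _ 2) ?nnegrE ?addr_ge0 ?eucl_dist_ge0// dE.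
by rewrite [leRHS]sqrrD pE qE; move: cs; lra.
Qed.

Lemma coord_le_eucl_dist (i : 'I_2) x y : `|x 0 i - y 0 i| <= eucl_dist x y.
Proof.
rewrite -(@ler_pXn2r _ 2) ?nnegrE ?eucl_dist_ge0// real_normK ?num_real//.
rewrite eucl_dist_sqr.
case: i => -[|[|//]] /= i2.
- have -> : Ordinal i2 = 0 by apply: val_inj.
  by rewrite lerDl sqr_ge0.
- have -> : Ordinal i2 = 1 by apply: val_inj.
  by rewrite lerDr sqr_ge0.
Qed.

Lemma eucl_dist_le_coords x y :
  eucl_dist x y <= `|x 0 0 - y 0 0| + `|x 0 1 - y 0 1|.
Proof.
rewrite -(@ler_pXn2r _ 2) ?nnegrE ?eucl_dist_ge0 ?addr_ge0//.
rewrite eucl_dist_sqr [leRHS]sqrrD !real_normK ?num_real//.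
have := mulr_ge0 (normr_ge0 (x 0 0 - y 0 0)) (normr_ge0 (x 0 1 - y 0 1)).
lra.
Qed.

(** The topology of the plane is given by balls of the sup norm; this lemma and
    the next one compare them with Euclidean ones. *)
Lemma ball_eucl_dist x y r : eucl_dist x y < r -> ball x r y.
Proof.
move=> xyr; split; first by apply: le_lt_trans xyr; exact: eucl_dist_ge0.
move=> i j; rewrite (ord1 i) /ball/= /ball_/=.
exact: le_lt_trans (coord_le_eucl_dist _ _ _) xyr.
Qed.

Lemma eucl_dist_ball x y r : ball x r y -> eucl_dist x y < 2 * r.
Proof.
move=> xyr; apply: le_lt_trans (eucl_dist_le_coords _ _) _.
have [_ xyr'] := xyr.
have := xyr' 0 0; have := xyr' 0 1.
rewrite /ball/= /ball_/=; lra.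
Qed.

End EuclideanPlane.

(** * One-dimensional Hausdorff measure *)

(** The half-open cell containing [t] is found by truncation, except at the
    right end of the grid, which belongs to the last cell. *)
Lemma grid_cell (R : archiRealFieldType) (n : nat) (h t : R) :
  (0 < n)%N -> 0 <= h -> 0 <= t <= n%:R * h ->
  exists2 i, (i < n)%N & i%:R * h <= t <= i.+1%:R * h.
Proof.
move=> n0 h0 /andP[t0 tn].
have [h00|hn0] := eqVneq h 0.
  by exists 0%N => //; rewrite h00 !mulr0 in tn *; rewrite t0.
have {hn0}h_gt0 : 0 < h by rewrite lt_neqAle eq_sym hn0.
have th0 : 0 <= t / h by rewrite divr_ge0.
pose q := Num.truncn (t / h).
have qle : q%:R * h <= t by rewrite -ler_pdivlMr// truncn_le.
have qlt : t < q.+1%:R * h by rewrite -ltr_pdivrMr// truncnS_gt.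
have [qn|nq] := ltnP q n; first by exists q => //; rewrite qle ltW.
exists n.-1; rewrite prednK// tn andbT.
apply: le_trans qle; rewrite ler_wpM2r// ler_nat.
exact: leq_trans (leq_pred n) nq.
Qed.

Section HausdorffMeasure.
Variable R : realType.
Implicit Types (x y z : 'rV[R]_2) (U V E : set 'rV[R]_2) (d r : R).

(** A real-valued form of the bound [diam U <= r], which dispenses with the
    extended reals and with the convention on the empty set. *)
Definition diam_le U r := forall x y, U x -> U y -> eucl_dist x y <= r.

Lemma diam_ge0 U : (0 <= diam U)%E.
Proof. by rewrite /diam le_max lexx. Qed.

Lemma diam_leP U r : 0 <= r -> (diam U <= r%:E)%E <-> diam_le U r.
Proof.
move=> r0; rewrite /diam ge_max lee_fin r0 /=; split.
  move=> /ereal_supP Ur x y Ux Uy; rewrite -lee_fin; apply: Ur.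
  by exists (x, y).
by move=> Ur; apply/ereal_supP => _ [[x y] [/= Ux Uy] <-]; rewrite lee_fin Ur.
Qed.

Lemma hausdorff1_delta_ge0 d E : (0 <= hausdorff1_delta d E)%E.
Proof.
apply/ereal_infP => _ [U _ <-].
by apply: nneseries_ge0 => k _ _; exact: diam_ge0.
Qed.

Lemma hausdorff1_ge0 E : (0 <= hausdorff1 E)%E.
Proof.
apply: le_ereal_sup_tmp; exists (hausdorff1_delta 1 E).
  by exists 1 => //=.
exact: hausdorff1_delta_ge0.
Qed.

Lemma hausdorff1_delta_set0 d : 0 <= d -> hausdorff1_delta d set0 = 0%E.
Proof.
move=> d0; apply/eqP; rewrite eq_le hausdorff1_delta_ge0 andbT.
have D0 : diam (set0 : set 'rV[R]_2) = 0%E.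
  by apply/eqP; rewrite eq_le diam_ge0 andbT; apply/diam_leP => // x y [].
apply: ge_ereal_inf; exists 0%E => //; exists (fun=> set0).
  by split=> [x []//|k]; rewrite D0 lee_fin.
by rewrite eseries0.
Qed.

Lemma le_hausdorff1_delta d E V : E `<=` V ->
  (hausdorff1_delta d E <= hausdorff1_delta d V)%E.
Proof.
move=> EV; apply/ereal_infP => _ [U [VU Ud] <-].
apply: ge_ereal_inf; eexists; last exact: lexx.
by exists U => //; split=> //; exact: subset_trans VU.
Qed.

Lemma hausdorff1_delta_le d E : 0 < d ->
  (hausdorff1_delta d E <= hausdorff1 E)%E.
Proof. by move=> d0; apply: ereal_sup_ubound; exists d. Qed.

Lemma le_hausdorff1 E V : E `<=` V -> (hausdorff1 E <= hausdorff1 V)%E.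
Proof.
move=> EV; apply/ereal_supP => _ [d /= d0 <-].
exact: le_trans (le_hausdorff1_delta _ EV) (hausdorff1_delta_le _ d0).
Qed.

(** Put the extra set in front of an almost optimal cover. *)
Lemma hausdorff1_delta_setU1 d E V r : 0 <= r <= d -> diam_le V r ->
  (hausdorff1_delta d (E `|` V) <= hausdorff1_delta d E + r%:E)%E.
Proof.
move=> /andP[r0 rd] /(diam_leP _ r0) Vr; rewrite -leeBlDr//.
apply/ereal_infP => _ [U [EU Ud] <-]; rewrite leeBlDr//.
pose W k := if k is k'.+1 then U k' else V.
apply: ge_ereal_inf; exists (\sum_(0 <= k <oo) diam (W k))%E.
  exists W => //; split=> [x [/EU[k _ Ukx]|Vx]|[|k]].
  - by exists k.+1.
  - by exists 0%N.
  - by rewrite /=; apply: le_trans Vr _; rewrite lee_fin.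
  - exact: Ud.
rewrite nneseries_recl//; last by move=> k _; exact: diam_ge0.
rewrite addeC; apply: leeD => //.
rewrite -(@nneseries_addn _ _ 1)//; last by move=> k; exact: diam_ge0.
by under eq_eseriesr do rewrite addn1.
Qed.

Lemma hausdorff1_delta_bigcup d E n (V : nat -> set 'rV[R]_2) (r : nat -> R) :
  (forall i, (i < n)%N -> 0 <= r i <= d /\ diam_le (V i) (r i)) ->
  (hausdorff1_delta d (E `|` [set x | exists2 i, (i < n)%N & V i x]) <=
   hausdorff1_delta d E + (\sum_(i < n) r i)%:E)%E.
Proof.
elim: n => [|n IHn] Vr.
  rewrite big_ord0 adde0; apply: le_hausdorff1_delta.
  by move=> x [//|[]].
rewrite big_ord_recr /= EFinD addeA.
have [rn Vn] := Vr n (ltnSn n).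
apply: le_trans (leeD2r _ (IHn (fun i lin => Vr i (ltnW lin)))).
apply: le_trans (hausdorff1_delta_setU1 _ rn Vn).
apply: le_hausdorff1_delta => x [Ex|[i]]; first by left; left.
rewrite ltnS leq_eqVlt => /orP[/eqP->|lin Vix]; first by right.
by left; right; exists i.
Qed.

(** Cut the parameter interval into equal pieces so short that each of them has
    an image of diameter at most [d]. *)
Lemma hausdorff1_setU_lipschitz E (g : R -> 'rV[R]_2) (C a b : R) :
  0 <= C -> a <= b ->
  {in `[a, b]%R &, forall s t, eucl_dist (g s) (g t) <= C * `|s - t|} ->
  (hausdorff1 (E `|` g @` `[a, b]) <= hausdorff1 E + (C * (b - a))%:E)%E.
Proof.
move=> C0 ab glip; apply/ereal_supP => _ [d /= d0 <-].
apply: le_trans (leeD2r _ (hausdorff1_delta_le E d0)).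
have CBA0 : 0 <= C * (b - a) by rewrite mulr_ge0// subr_ge0.
have [n n_gt0 nd] : exists2 n, (0 < n)%N & C * (b - a) <= d * n%:R.
  exists (Num.bound (C * (b - a) / d)).+1 => //.
  rewrite [leRHS]mulrC -ler_pdivrMr// ltW//.
  apply: lt_le_trans (archi_boundP _) _; first by rewrite divr_ge0// ltW.
  by rewrite ler_nat.
have n0 : 0 < n%:R :> R by rewrite ltr0n.
pose h := (b - a) / n%:R.
have h0 : 0 <= h by rewrite divr_ge0 ?subr_ge0// ltW.
have nh : n%:R * h = b - a by rewrite /h mulrC divfK// gt_eqF.
have Chd : C * h <= d by rewrite /h mulrA ler_pdivrMr.
pose V (i : nat) := g @` `[a + i%:R * h, a + i.+1%:R * h].
have -> : C * (b - a) = \sum_(i < n) (C * h).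
  by rewrite sumr_const card_ord -mulr_natl mulrCA nh.
apply: le_trans (@hausdorff1_delta_bigcup d E n V (fun=> C * h) _).
  apply: le_hausdorff1_delta => x [Ex|[t]]; first by left.
  rewrite /= in_itv /= => /andP[a_t tb] gtx; right.
  have [|i lin /andP[il iu]] := @grid_cell _ n h (t - a) n_gt0 h0.
    by rewrite nh; apply/andP; split; lra.
  by exists i => //; exists t => //=; rewrite in_itv/=; apply/andP; split; lra.
move=> i lin; rewrite mulr_ge0// Chd; split=> //.
have inab s : s \in `[a + i%:R * h, a + i.+1%:R * h]%R -> s \in `[a, b]%R.
  rewrite !in_itv /= => /andP[sl su].
  have : 0 <= i%:R * h by rewrite mulr_ge0.
  have : i.+1%:R * h <= n%:R * h by rewrite ler_wpM2r// ler_nat.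
  by rewrite nh => ? ?; apply/andP; split; lra.
move=> _ _ [s si <-] [t ti <-].
apply: le_trans (glip _ _ (inab _ si) (inab _ ti)) _.
rewrite ler_wpM2l// ler_norml; move: si ti.
rewrite /= !in_itv /= -natr1 mulrDl mul1r => /andP[? ?] /andP[? ?].
by apply/andP; split; lra.
Qed.

End HausdorffMeasure.

(** * A lower bound for length *)

Section LowerBound.
Variable R : realType.

(** At scales below [e] the function does not increase diameters, so a cover of
    [E] by sets of diameter at most [e] is sent to a cover of the interval by
    intervals that are no longer, and the Lebesgue measure is subadditive. The
    condition on [f] being local, distinct far apart pieces of [E] may be laid
    end to end on the line. *)
Lemma hausdorff1_ge_length (E : set 'rV[R]_2) (f : 'rV[R]_2 -> R) (e a b : R) :
  0 < e ->
  (forall p q, E p -> E q -> eucl_dist p q <= e ->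
    `|f p - f q| <= eucl_dist p q) ->
  `[a, b] `<=` f @` E ->
  ((b - a)%:E <= hausdorff1 E)%E.
Proof.
move=> e0 flip abE.
have [ba|ab] := leP b a.
  by apply: le_trans (hausdorff1_ge0 E); rewrite lee_fin subr_le0.
apply: le_trans (hausdorff1_delta_le E e0).
apply/ereal_infP => _ [U [EU Ue] <-].
pose D k := fine (diam (U k)).
have DE k : diam (U k) = (D k)%:E.
  rewrite fineK// ge0_fin_numE ?diam_ge0//.
  exact: le_lt_trans (Ue k) (ltry _).
have D0 k : 0 <= D k by rewrite -lee_fin -DE diam_ge0.
have UD k : diam_le (U k) (D k) by apply/diam_leP; rewrite ?DE.
have De k : D k <= e by rewrite -lee_fin -DE.
pose S k := f @` (U k `&` E).
pose J k := `[inf (S k), inf (S k) + D k]%classic.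
have SJ k : S k `<=` J k.
  move=> t St.
  have lbS : lbound (S k) (t - D k).
    move=> _ [q [Uq Eq] <-]; case: St => p [Up Ep] <-.
    have := flip p q Ep Eq (le_trans (UD k p q Up Uq) (De k)).
    by move=> /le_trans/(_ (UD k p q Up Uq)); rewrite ler_norml => /andP[]; lra.
  rewrite /J /= in_itv/= -lerBlDr; apply/andP; split.
    by apply: ge_inf => //; exists (t - D k).
  by apply: lb_le_inf => //; exists t.
have JE k : lebesgue_measure (J k) = (D k)%:E.
  rewrite /J lebesgue_measure_itv/= lte_fin ltrDl.
  have [Dp|] := ltP 0 (D k); first by rewrite -EFinD addrAC subrr add0r.
  by move=> Dn; congr EFin; apply/eqP; rewrite eq_le D0 Dn.
have -> : ((b - a)%:E = lebesgue_measure `[a, b]%classic)%E.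
  by rewrite lebesgue_measure_itv/= lte_fin ab.
under eq_eseriesr => k _ do rewrite DE -JE.
apply: measure_sigma_subadditive => [k||].
- exact: measurable_itv.
- exact: measurable_itv.
move=> t /abE[p Ep <-]; have [k _ Ukp] := EU _ Ep.
by exists k => //; apply: SJ; exists p.
Qed.

End LowerBound.

(** * Gathering linked small sets into clusters *)

Lemma sum_update (R : zmodType) m i (r : nat -> R) v : (i < m)%N ->
  \sum_(k < m) (if k == i :> nat then v else r k) =
  \sum_(k < m) r k - r i + v.
Proof.
move=> im; rewrite (bigD1 (Ordinal im))//= eqxx [in RHS](bigD1 (Ordinal im))//=.
rewrite addrC [r i + _]addrC addrK; congr (_ + _).
by apply: eq_bigr => k; rewrite -val_eqE/= => /negbTE->.
Qed.

Lemma diam_leU (R : realType) (U V : set 'rV[R]_2) r s :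
  U `&` V !=set0 -> 0 <= r -> 0 <= s -> diam_le U r -> diam_le V s ->
  diam_le (U `|` V) (r + s).
Proof.
move=> [z [Uz Vz]] r0 s0 Ur Vs x y [Ux|Vx] [Uy|Vy].
- by apply: le_trans (Ur _ _ Ux Uy) _; rewrite lerDl.
- by apply: le_trans (eucl_distD z x y) _; rewrite lerD ?Ur ?Vs.
- by apply: le_trans (eucl_distD z x y) _; rewrite addrC lerD ?Ur ?Vs.
- by apply: le_trans (Vs _ _ Vx Vy) _; rewrite lerDr.
Qed.

(** The intersection graph of [B 0], ..., [B m] contains a tree rooted at [B 0]
    in which every set comes after its parent. *)
Definition linked (T : Type) (B : nat -> set T) m :=
  forall k, (0 < k <= m)%N -> exists2 i, (i < k)%N & B i `&` B k !=set0.

(** The sets [S k] are the clusters under construction, one per vertex [B k] of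
    the tree, with [r k] bounding their diameters. The last vertex is a leaf:
    its cluster is absorbed by the one of its parent. If the result is still
    small the construction goes on with one vertex fewer; otherwise it is
    output as a finished cluster, and the parent restarts from [B i] alone,
    which keeps it available to the remaining vertices and costs [eta]. Hence
    [n], the number of finished clusters besides the last one, is paid for by
    the total of the diameters, increased by [n * eta]. *)
Lemma cluster_merge (R : realType) (B : nat -> set 'rV[R]_2) (eta d : R) m :
  0 <= eta < d -> (forall k, (k <= m)%N -> diam_le (B k) eta) -> linked B m ->
  forall (S : nat -> set 'rV[R]_2) (r : nat -> R),
  (forall k, (k <= m)%N ->
    [/\ B k `<=` S k, diam_le (S k) (r k) & 0 <= r k < d]) ->
  exists n (C : nat -> set 'rV[R]_2) (c : nat -> R),
  [/\ forall k x, (k <= m)%N -> S k x -> exists2 i, (i < n.+1)%N & C i x,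
      forall i, (i < n.+1)%N -> 0 <= c i <= 2 * d /\ diam_le (C i) (c i),
      \sum_(i < n.+1) c i <= \sum_(k < m.+1) r k + n%:R * eta &
      n%:R * d <= \sum_(k < m.+1) r k + n%:R * eta].
Proof.
move=> /andP[eta0 etad]; elim: m => [|m IHm] Beta link S r Sr.
  exists 0%N, S, r; have [_ S0 /andP[r0 rd]] := Sr 0%N isT; split.
  - by move=> k x; rewrite leqn0 => /eqP-> ?; exists 0%N.
  - by case=> // _; split=> //; apply/andP; split; lra.
  - by rewrite mul0r addr0.
  - by rewrite !mul0r addr0 big_ord1.
have {}IHm := IHm (fun k km => Beta k (leqW km)).
have /IHm{}IHm : linked B m.
  by move=> k /andP[k0 km]; apply: link; rewrite k0 leqW.
have [i im [z [Biz Bmz]]] := link m.+1 (leqnn _).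
have [BSm Sm /andP[rm0 rmd]] := Sr m.+1 (leqnn _).
have [BSi Si /andP[ri0 rid]] := Sr i (ltnW im).
pose M := S i `|` S m.+1.
have Mr : diam_le M (r i + r m.+1).
  by apply: diam_leU => //; exists z; split; [exact: BSi|exact: BSm].
have [small|large] := ltP (r i + r m.+1) d.
- pose S' k := if k == i then M else S k.
  pose r' k := if k == i then r i + r m.+1 else r k.
  have [|n [C [c [cov Cc csum cn]]]] := IHm S' r'.
    move=> k km; rewrite /S' /r'; case: eqVneq => [->|_];
      last exact: Sr (leqW km).
    by split; [move=> x /BSi; left|exact: Mr|rewrite addr_ge0].
  have sumE : \sum_(k < m.+1) r' k = \sum_(k < m.+2) r k.
    by rewrite /r' sum_update// [RHS]big_ord_recr/= addrA subrK.
  exists n, C, c; rewrite -sumE; split=> //.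
  move=> k x; rewrite leq_eqVlt => /orP[/eqP-> Sx|km Sx].
    by apply: (cov i) => //; rewrite /S' eqxx; right.
  apply: (cov k) => //; rewrite /S'.
  by case: eqVneq => // ki; left; rewrite -ki.
- pose S' k := if k == i then B i else S k.
  pose r' k := if k == i then eta else r k.
  have [|n [C [c [cov Cc csum cn]]]] := IHm S' r'.
    move=> k km; rewrite /S' /r'; case: eqVneq => [->|_];
      last exact: Sr (leqW km).
    by split; [by []|exact: Beta (ltnW im)|rewrite eta0].
  have sumE : \sum_(k < m.+1) r' k =
      \sum_(k < m.+2) r k - (r i + r m.+1) + eta.
    rewrite /r' sum_update// [in RHS]big_ord_recr/=; ring.
  rewrite sumE in csum cn.
  exists n.+1, (fun j => if j is j'.+1 then C j' else M),
    (fun j => if j is j'.+1 then c j' else r i + r m.+1); split.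
  + move=> k x; rewrite leq_eqVlt => /orP[/eqP-> Sx|km Sx].
      by exists 0%N => //; right.
    have [ki|ki] := eqVneq k i; first by exists 0%N => //; left; rewrite -ki.
    have [|j jn Cjx] := cov k x km; first by rewrite /S' (negbTE ki).
    by exists j.+1.
  + case=> [_|j]; last exact: Cc.
    by split=> //; apply/andP; split; lra.
  + rewrite big_ord_recl /bump/= -natr1;
    rewrite mulrDl mul1r; lra.
  + by rewrite -natr1 mulrDl mul1r mulrDl mul1r; lra.
Qed.

Lemma connected_sub_open (T : topologicalType) (E A B : set T) :
  connected E -> open A -> open B -> E `<=` A `|` B ->
  (forall x, E x -> A x -> ~ B x) -> E `&` A !=set0 -> E `<=` A.
Proof.
move=> Econn Ao Bo EAB AB EA0.
suff <- : E `&` A = E by move=> x [].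
apply: Econn => //; first by exists A.
exists (~` B); first exact: open_closedC.
by apply/seteqP; split=> x [Ex]; [split=> //; exact: AB|case: (EAB x Ex)].
Qed.

(** Whenever the sets listed so far do not exhaust the family, one of the
    others meets one of them, since otherwise the two unions would disconnect
    [E]. *)
Lemma connected_linked_cover (T : topologicalType) (E : set T)
    (V : nat -> set T) (s : seq nat) :
  connected E -> {in s, forall k, open (V k)} ->
  {in s, forall k, E `&` V k !=set0} ->
  (forall x, E x -> exists2 k, k \in s & V k x) ->
  exists2 t, perm_eq s t & linked (V \o nth 0%N t) (size t).-1.
Proof.
move=> Econn Vo VE Ecov.
suff [t [t' [stt' tE tl]]] : exists t t', [/\ perm_eq s (t ++ t'),
    size t = size s & linked (V \o nth 0%N t) (size t).-1].
  have : size t' = 0%N.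
    by apply/esym/(@addnI (size t)); rewrite addn0 -size_cat -(perm_size stt').
  by move=> /size0nil t'0; exists t; rewrite // -[t]cats0 -t'0.
elim: {-2}(size s) (leqnn (size s)) => [_|n IHn ns].
  by exists [::], s; split=> // k /andP[]; case: k.
have [t [t' [stt' tn tl]]] := IHn (ltnW ns).
have szE := perm_size stt'; rewrite size_cat in szE.
have [k0 k0t'] : exists k, k \in t'.
  case: (t') szE => [|k t'' _]; first by rewrite /= tn; lia.
  by exists k; rewrite mem_head.
have [t0|t0] := eqVneq t [::].
  exists [:: k0], (rem k0 t'); split => //=; last 1 first.
  - by move=> k /andP[]; case: k.
  - by rewrite (perm_trans stt')// t0 cat0s perm_to_rem.
  - by rewrite -tn t0.
have mems k : (k \in s) = (k \in t) || (k \in t').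
  by rewrite (perm_mem stt') mem_cat.
have [i [j [it jt' ij]]] : exists i j,
    [/\ i \in t, j \in t' & V i `&` V j !=set0].
  apply: contrapT => noij.
  pose A := \bigcup_(k in [set` t]) V k.
  pose A' := \bigcup_(k in [set` t']) V k.
  have EA : E `<=` A.
    apply: (connected_sub_open Econn (B := A')).
    - by apply: bigcup_open => k kt; apply: Vo; rewrite mems kt.
    - by apply: bigcup_open => k kt; apply: Vo; rewrite mems kt orbT.
    - move=> x /Ecov[k + Vkx]; rewrite mems => /orP[kt|kt].
        by left; exists k.
      by right; exists k.
    - move=> x _ [i it Vix] [j jt' Vjx]; apply: noij.
      by exists i, j; split=> //; exists x.
    - have ht : head 0%N t \in t by case: (t) t0 => //= a l _; exact: mem_head.
      have [|x [Ex Vx]] := VE (head 0%N t); first by rewrite mems ht.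
      by exists x; split => //; exists (head 0%N t).
  have [|x [Ex Vx]] := VE k0; first by rewrite mems k0t' orbT.
  have [i it Vix] := EA x Ex.
  by apply: noij; exists i, k0; split=> //; exists x.
exists (rcons t j), (rem j t'); split.
- rewrite (perm_trans stt')// -cats1 -catA perm_cat2l cat1s.
  by rewrite perm_to_rem.
- by rewrite size_rcons tn.
- rewrite size_rcons/= => k /andP[k_gt0 kt].
  move: kt; rewrite leq_eqVlt => /orP[/eqP kt|kt].
    exists (index i t); first by rewrite kt index_mem.
    by rewrite /= !nth_rcons index_mem it nth_index// kt ltnn eqxx.
  have [|h hk hV] := tl k; first by rewrite k_gt0 -ltnS (ltn_predK kt).
  by exists h => //; rewrite /= !nth_rcons kt (ltn_trans hk kt).
Qed.

(** * Uniformly finite covers of continua *)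

Section UniformCovers.
Variable R : realType.
Implicit Types (E : set 'rV[R]_2) (L d eps : R).

(** An almost optimal countable cover is fattened into an open one, at a cost
    summing up to at most [eps / 2], and compactness extracts a finite part. *)
Lemma small_open_cover E L eta eps :
  compact E -> (hausdorff1 E <= L%:E)%E -> 0 < eta -> 0 < eps ->
  exists M (V : nat -> set 'rV[R]_2) (f : nat -> R),
  [/\ forall k, open (V k),
      forall k, 0 <= f k <= eta /\ diam_le (V k) (f k),
      E `<=` \bigcup_(k < M) V k &
      \sum_(k < M) f k <= L + eps].
Proof.
move=> Ecpt EL eta0 eps0.
have eta20 : 0 < eta / 2 by rewrite divr_gt0.
have hL := le_trans (hausdorff1_delta_le E eta20) EL.
have hfin : hausdorff1_delta (eta / 2) E \is a fin_num.
  by rewrite ge0_fin_numE ?hausdorff1_delta_ge0// (le_lt_trans hL)// ltry.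
have eps20 : 0 < eps / 2 by rewrite divr_gt0.
have [_ [U [EU Ueta] <-] Usum] := lb_ereal_inf_adherent eps20 hfin.
pose D k := fine (diam (U k)).
have DE k : diam (U k) = (D k)%:E.
  rewrite fineK// ge0_fin_numE ?diam_ge0//.
  exact: le_lt_trans (Ueta k) (ltry _).
have D0 k : 0 <= D k by rewrite -lee_fin -DE diam_ge0.
have UD k : diam_le (U k) (D k) by apply/diam_leP; rewrite ?DE.
have De k : D k <= eta / 2 by rewrite -lee_fin -DE.
(* Points of [V k] are within [rho k / 2] of [U k], a sup norm ball of radius
   [rho k / 4] being contained in the Euclidean ball of twice that radius. *)
pose rho k := Num.min (eta / 2) (eps / 2 / (2 ^ k.+1)%:R).
have rho0 k : 0 < rho k.
  by rewrite lt_min eta20 divr_gt0// ltr0n expn_gt0.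
have rho40 k : 0 < rho k / 4 by rewrite divr_gt0.
pose V k := \bigcup_(y in U k) ball y (rho k / 4).
have Vo k : open (V k) by apply: bigcup_open => y _; exact: ball_open.
have [D' _ D'cov] : finite_subset_cover setT V E.
  have := Ecpt; rewrite compact_cover; apply => // x /EU[k _ Ukx].
  by exists k => //; exists x => //; exact: ballxx.
exists (\max_(k <- D') k).+1, V, (fun k => D k + rho k); split => //.
- move=> k; have r0 := rho0 k; split.
    have : rho k <= eta / 2 by rewrite ge_min lexx.
    have := De k; have := D0 k; move=> *; apply/andP; split; lra.
  move=> x y [x' Ux' /ball_sym/eucl_dist_ball xx'].
  move=> [y' Uy' /eucl_dist_ball yy'].
  have xy' := UD _ _ _ Ux' Uy'.
  have := eucl_distD x' x y; have := eucl_distD y' x' y; lra.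
- move=> x /D'cov[k kD' Vkx]; exists k => //=.
  by rewrite ltnS; exact: (@leq_bigmax_seq _ _ xpredT id).
- rewrite -lee_fin.
  apply: (@le_trans _ _ (\sum_(0 <= k <oo)
      (diam (U k) + (eps / 2 / (2 ^ k.+1)%:R)%:E))%E).
    rewrite -sumEFin -(big_mkord xpredT (fun k => (D k + rho k)%:E)).
    apply: le_trans; last apply: nneseries_lim_ge.
      apply: lee_sum => k _; rewrite DE -EFinD lee_fin lerD2l.
      by rewrite ge_min lexx orbT.
    move=> k _ _; apply: adde_ge0; first exact: diam_ge0.
    by rewrite lee_fin divr_ge0// ltW.
  apply: le_trans (epsilon_trick _ _ _) _ => //; last 2 first.
  - exact: ltW.
  - apply: (@le_trans _ _ ((L%:E + (eps / 2)%:E) + (eps / 2)%:E)%E).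
      by rewrite leeD2r//; apply: le_trans (ltW Usum) _; rewrite leeD2r.
    by rewrite -!EFinD lee_fin; lra.
  - by move=> k; exact: diam_ge0.
Qed.

(** [N] depends on [L], [d] and [eps] only, and not on [E]: this is what
    survives in Hausdorff limits. It is obtained by merging, up to diameter
    [d], a cover by sets of diameter [eta] with [N * eta <= eps / 2]. *)
Lemma connected_uniform_cover L d eps : 0 <= L -> 0 < d -> 0 < eps ->
  exists N : nat, forall E, compact E -> connected E ->
    (hausdorff1 E <= L%:E)%E ->
    exists n (C : nat -> set 'rV[R]_2) (c : nat -> R),
    [/\ (n <= N)%N, E `<=` \bigcup_(i < n) C i,
        forall i, (i < n)%N -> 0 <= c i <= d /\ diam_le (C i) (c i) &
        \sum_(i < n) c i <= L + eps].
Proof.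
move=> L0 d0 eps0.
pose N := (Num.bound (4 * (L + eps) / d)).+1.
have NE : 4 * (L + eps) < N%:R * d.
  rewrite -ltr_pdivrMr//; apply: lt_le_trans (archi_boundP _) _.
    by rewrite divr_ge0 ?mulr_ge0 ?addr_ge0// ltW.
  by rewrite ler_nat.
have N0 : 0 < N%:R :> R by rewrite ltr0n.
exists N.+1 => E Ecpt Econn EL.
(* As [eta <= d / 4], at least half of the size [d / 2] of a finished cluster is
   not accounted for by its root; hence there are at most [4 * (L + eps) / d]
   of them. *)
pose eta := Num.min (d / 4) (eps / 2 / N%:R).
have eta0 : 0 < eta by rewrite lt_min !divr_gt0.
have etad : eta <= d / 4 by rewrite ge_min lexx.
have Neta : N%:R * eta <= eps / 2.
  by rewrite mulrC -ler_pdivlMr// ge_min lexx orbT.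
have eps20 : 0 < eps / 2 by rewrite divr_gt0.
have [M [V [f [Vo Vf VE fsum]]]] := small_open_cover Ecpt EL eta0 eps20.
pose s := [seq k <- iota 0 M | `[< E `&` V k !=set0 >]].
have fs : \sum_(k <- s) f k <= L + eps / 2.
  apply: le_trans fsum; rewrite big_filter -(big_mkord xpredT f).
  rewrite /index_iota subn0.
  rewrite big_mkcond; apply: ler_sum => k _; case: ifP => // _.
  by have [/andP[]] := Vf k.
have [t pst tl] : exists2 t, perm_eq s t & linked (V \o nth 0%N t) (size t).-1.
  apply: (connected_linked_cover Econn).
  - by move=> k _.
  - by move=> k; rewrite mem_filter => /andP[/asboolP].
  - move=> x Ex; have [k kM Vkx] := VE x Ex; exists k => //.
    by rewrite mem_filter mem_iota /= add0n kM andbT; apply/asboolP; exists x.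
have Et x : E x -> exists2 k, (k < size t)%N & V (nth 0%N t k) x.
  move=> Ex; have [k kM Vkx] := VE x Ex.
  have kt : k \in t.
    rewrite -(perm_mem pst) mem_filter mem_iota /= add0n kM andbT.
    by apply/asboolP; exists x.
  by exists (index k t); rewrite ?index_mem// nth_index.
have [t0|tn0] := posnP (size t).
  exists 0%N, (fun=> set0), (fun=> 0); split => //.
    by move=> x /Et[k]; rewrite t0.
  by rewrite big_ord0 addr_ge0// ltW.
have ft : \sum_(k < (size t).-1.+1) (f \o nth 0%N t) k <= L + eps / 2.
  rewrite prednK// -(big_mkord xpredT (f \o nth 0%N t)) -(big_nth 0%N xpredT f).
  by rewrite -(perm_big _ pst).
have [|||n [C [c [cov Cc csum cn]]]] :=
    @cluster_merge _ (V \o nth 0%N t) eta (d / 2) (size t).-1 _ _ tl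
      (V \o nth 0%N t) (f \o nth 0%N t).
- by rewrite ltW//=; lra.
- move=> k _ x y Vx Vy; have [/andP[_ fe] /(_ x y Vx Vy)] := Vf (nth 0%N t k).
  by move=> /le_trans; apply.
- move=> k _; have [/andP[f0 fe] Vd] := Vf (nth 0%N t k); split => //.
  by rewrite /= f0; lra.
have nN : (n <= N)%N.
  rewrite -(ler_nat R) -(ler_pM2r d0).
  have : n%:R * eta <= n%:R * (d / 4) by rewrite ler_wpM2l.
  lra.
exists n.+1, C, c; split => //.
- move=> x /Et[k kt Vx]; have [|i] := cov k x _ Vx.
    by rewrite -ltnS prednK.
  by exists i.
- by move=> i /Cc[]; rewrite mulrC divfK.
- apply: le_trans csum _.
  have : n%:R * eta <= N%:R * eta by rewrite ler_wpM2r ?ler_nat// ltW.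
  lra.
Qed.

End UniformCovers.

(** * Hausdorff limits of continua *)

Section Golab.
Variable R : realType.
Implicit Types (E G K : set 'rV[R]_2) (L d eps rho : R).

(** Golab's semicontinuity theorem. A single [G], close enough to [E], gives
    the estimate at scale [d]: the number of sets covering [G] is bounded by an
    [N] known before [rho] is chosen, so that all of them may be thickened. *)
Lemma golab_hausdorff1_le E L : 0 <= L ->
  (forall rho, 0 < rho -> exists G,
    [/\ compact G, connected G, (hausdorff1 G <= L%:E)%E &
        forall x, E x -> exists2 y, G y & eucl_dist x y <= rho]) ->
  (hausdorff1 E <= L%:E)%E.
Proof.
move=> L0 approx; apply/ereal_supP => _ [d /= d0 <-].
apply/lee_addgt0Pr => eps eps0.
have d20 : 0 < d / 2 by rewrite divr_gt0.
have eps20 : 0 < eps / 2 by rewrite divr_gt0.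
have [N Ncov] := connected_uniform_cover L0 d20 eps20.
pose rho := Num.min (d / 4) (eps / 4 / N.+1%:R).
have rho0 : 0 < rho by rewrite lt_min !divr_gt0.
have rhod : rho <= d / 4 by rewrite ge_min lexx.
have Nrho : N.+1%:R * rho <= eps / 4.
  by rewrite mulrC -ler_pdivlMr// ge_min lexx orbT.
have [G [Gcpt Gconn GL EG]] := approx rho rho0.
have [n [C [c [nN GC Cc csum]]]] := Ncov G Gcpt Gconn GL.
pose C' i := [set x | exists2 y, C i y & eucl_dist x y <= rho].
apply: (@le_trans _ _ (hausdorff1_delta d
    (set0 `|` [set x | exists2 i, (i < n)%N & C' i x]))).
  apply: le_hausdorff1_delta => x /EG[y Gy xy]; right.
  by have [i lin Ciy] := GC y Gy; exists i => //; exists y.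
apply: le_trans (@hausdorff1_delta_bigcup _ d set0 n C'
    (fun i => c i + 2 * rho) _) _; last first.
  rewrite (hausdorff1_delta_set0 (ltW d0)) add0e -EFinD lee_fin big_split/=.
  rewrite sumr_const card_ord -mulr_natl.
  have : n%:R * rho <= N.+1%:R * rho by rewrite ler_wpM2r ?ler_nat ?leqW// ltW.
  lra.
move=> i /Cc[/andP[ci0 cid] Ci]; split; first by apply/andP; split; lra.
move=> x y [x' Cx' xx'] [y' Cy' yy'].
have := Ci _ _ Cx' Cy'; have := eucl_distD x' x y; have := eucl_distD y' x' y.
rewrite (eucl_distC y' y); lra.
Qed.

(** A separation of the compact set [E] leaves a gap of positive width [r]
    between its two parts; a connected set that is [r / 5]-close to [E] would
    be separated too. *)
Lemma connected_of_approx E : compact E ->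
  (forall rho, 0 < rho -> exists G, [/\ connected G,
    forall x, E x -> exists2 y, G y & eucl_dist x y <= rho &
    forall y, G y -> exists2 x, E x & eucl_dist x y <= rho]) ->
  connected E.
Proof.
move=> Ecpt approx B [x0 Bx0] [Q Qo BQ] [F Fcl BF].
apply: contrapT => BE.
have Bsub : B `<=` E by move=> x; rewrite BQ => -[].
pose D := E `&` ~` Q.
have Bcpt : compact B by rewrite BF; apply: compact_closedI.
have Dcl : closed D.
  apply: closedI; last exact: open_closedC.
  exact: compact_closed (@norm_hausdorff _ _) Ecpt.
have EBD x : E x -> B x \/ D x.
  by move=> Ex; have [Qx|nQx] := pselect (Q x); [left; rewrite BQ|right].
have [x1 Dx1] : D !=set0.
  apply: contrapT => D0; apply: BE; apply/seteqP; split=> // x /EBD[//|Dx].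
  by exfalso; apply: D0; exists x.
have [r r0 gap] : exists2 r : R, 0 < r &
    forall x y, B x -> D y -> r <= eucl_dist x y.
  have nc : \forall r \near 0^'+,
      B `<=` (fun x => forall y, D y -> r <= eucl_dist x y).
    apply: (compact_near_coveringP B).1 => // x.
    rewrite BQ => -[_ Qx].
    have : nbhs x (~` D).
      by apply: open_nbhs_nbhs; split; [exact: closed_openC|move=> -[]].
    rewrite -nbhs_ballE => -[e /= e0 eD].
    have e20 : 0 < e / 2 by rewrite divr_gt0.
    exists (ball x (e / 2), [set r : R | r < e / 2]) => /=.
      split; first exact: nbhsx_ballx.
      exact: nbhs_right_lt.
    move=> [x' r] [/= xx' re] y Dy; rewrite leNgt; apply/negP => x'y.
    apply: (eD y) => //; rewrite [e]splitr; apply: ball_triangle xx' _.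
    by apply: ball_eucl_dist; exact: lt_trans re.
  have [r [r0 rgap]] := filter_ex (filterI (nbhs_right_gt (0 : R)) nc).
  by exists r => // x y Bx; exact: rgap.
have r50 : 0 < r / 5 by rewrite divr_gt0.
have [G [Gconn EG GE]] := approx _ r50.
pose OB := \bigcup_(x in B) ball x (r / 4).
pose OD := \bigcup_(x in D) ball x (r / 4).
have near_ball x y : eucl_dist x y <= r / 5 -> ball x (r / 4) y.
  by move=> xy; apply: ball_eucl_dist; lra.
have BDsep y : OB y -> ~ OD y.
  move=> [x Bx /eucl_dist_ball xy] [x' Dx' /eucl_dist_ball x'y].
  have := gap x x' Bx Dx'; have := eucl_distD y x x'.
  by rewrite (eucl_distC y x'); lra.
have GOB : G `<=` OB.
  apply: (connected_sub_open Gconn (B := OD)) => //.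
  - by apply: bigcup_open => *; exact: ball_open.
  - by apply: bigcup_open => *; exact: ball_open.
  - move=> y /GE[x /EBD[Bx|Dx] /near_ball xy]; first by left; exists x.
    by right; exists x.
  - by move=> y _; exact: BDsep.
  - have [y Gy /near_ball xy] := EG x0 (Bsub _ Bx0).
    by exists y; split=> //; exists x0.
have [y Gy /near_ball xy] := EG x1 Dx1.1.
by apply: (BDsep y (GOB y Gy)); exists x1.
Qed.

(** Sequences in a compact set converge along any ultrafilter, which replaces
    the repeated extraction of subsequences. *)
Lemma ultra_compact_limit K (U : set_system nat) (z : nat -> 'rV[R]_2) :
  UltraFilter U -> compact K -> (forall n, K (z n)) ->
  exists2 p, K p & forall r, 0 < r -> U [set n | eucl_dist p (z n) < r].
Proof.
move=> Uultra Kcpt Kz.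
have [|p [Kp pcl]] := Kcpt (z @ U) _.
  exact: (@filterS _ U _ setT _ (fun n _ => Kz n) filterT).
exists p => // r r0.
have r20 : 0 < r / 2 by rewrite divr_gt0.
have [//|Ur] := in_ultra_setVsetC [set n | eucl_dist p (z n) < r] Uultra.
have [|y [/= + pr]] := pcl [set y | r <= eucl_dist p y] (ball p (r / 2)) _
  (nbhsx_ballx _ _ r20).
  by apply: (@filterS _ U _ _ _ _ Ur) => n npr; rewrite /= leNgt; apply/negP.
by have := eucl_dist_ball pr; lra.
Qed.

(** [E] is the limit of [S] along a free ultrafilter, made of the points that
    are arbitrarily close to [S n] for almost all [n]. For any tolerance the
    indices [n] for which [S n] and [E] are close in both directions form a set
    of the ultrafilter: along a sequence of points violating this, compactness
    would give a limit point contradicting the definition of [E]. In particular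
    arbitrarily large such indices exist for each tolerance. *)
Lemma blaschke_selection K (S : nat -> set 'rV[R]_2) :
  compact K -> (forall n, S n `<=` K) -> (forall n, S n !=set0) ->
  exists E (phi : nat -> nat), [/\ closed E, E `<=` K, E !=set0 &
    forall k, [/\ (k <= phi k)%N,
      forall x, E x -> exists2 y, S (phi k) y & eucl_dist x y < k.+1%:R^-1 &
      forall y, S (phi k) y -> exists2 x, E x & eucl_dist x y < k.+1%:R^-1]].
Proof.
move=> Kcpt SK S0.
have [U [Uultra Uoo]] := ultraFilterLemma (F := \oo) _.
have Uproper : ProperFilter U by exact: ultra_proper.
pose E := [set x | forall r, 0 < r ->
  U [set n | exists2 y, S n y & eucl_dist x y < r]].
have Ecl : closed E.
  move=> x clx r r0.
  have r40 : 0 < r / 4 by rewrite divr_gt0.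
  have [x' [Ex' /eucl_dist_ball xx']] := clx _ (nbhsx_ballx x _ r40).
  apply: filterS (Ex' _ r40) => n [y Sy x'y]; exists y => //.
  by have := eucl_distD x' x y; lra.
have EK : E `<=` K.
  move=> x Ex; apply: (compact_closed (@norm_hausdorff _ _) Kcpt) => B.
  rewrite -nbhs_ballE => -[e /= e0 eB].
  have [n [y Sy xy]] := filter_ex (Ex e e0).
  by exists y; split; [exact: SK Sy|apply/eB/ball_eucl_dist].
have SE r : 0 < r -> U [set n | forall y, S n y ->
    exists2 x, E x & eucl_dist x y < r].
  move=> r0; have [//|UC] := in_ultra_setVsetC
    [set n | forall y, S n y -> exists2 x, E x & eucl_dist x y < r] Uultra.
  have /choice[z zP] : forall n, exists y, S n y /\
      ((exists2 y, S n y & forall x, E x -> r <= eucl_dist x y) ->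
       forall x, E x -> r <= eucl_dist x y).
    move=> n; have [[y Sy yr]|no] :=
      pselect (exists2 y, S n y & forall x, E x -> r <= eucl_dist x y).
      by exists y.
    by have [y Sy] := S0 n; exists y.
  have [|p Kp pU] := ultra_compact_limit (z := z) Uultra Kcpt.
    by move=> n; apply: (SK n); have [] := zP n.
  have Ep : E p.
    move=> s s0; apply: filterS (pU s s0) => n /= pz.
    by exists (z n) => //; have [] := zP n.
  have [n [/= nC pz]] := filter_ex (filterI UC (pU r r0)).
  exfalso; apply: nC => y Sy; apply: contrapT => nox.
  suff : r <= eucl_dist p (z n) by rewrite leNgt pz.
  apply: (zP n).2 => //; exists y => // x Ex; rewrite leNgt; apply/negP => xy.
  by apply: nox; exists x.
have [x0 Ex0] : E !=set0.
  have [n nE] := filter_ex (SE 1 ltr01).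
  by have [y /nE[x Ex _]] := S0 n; exists x.
have ES r : 0 < r -> U [set n | forall x, E x ->
    exists2 y, S n y & eucl_dist x y < r].
  move=> r0; have [//|UC] := in_ultra_setVsetC
    [set n | forall x, E x -> exists2 y, S n y & eucl_dist x y < r] Uultra.
  have /choice[z zP] : forall n, exists x, E x /\
      ((exists2 x, E x & forall y, S n y -> r <= eucl_dist x y) ->
       forall y, S n y -> r <= eucl_dist x y).
    move=> n; have [[x Ex xr]|no] :=
      pselect (exists2 x, E x & forall y, S n y -> r <= eucl_dist x y).
      by exists x.
    by exists x0.
  have r20 : 0 < r / 2 by rewrite divr_gt0.
  have [||p Ep pU] := ultra_compact_limit (K := E) (z := z) Uultra.
  - exact: subclosed_compact Ecl Kcpt EK.
  - by move=> n; have [] := zP n.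
  have [n [/= nC [pz [y Sy py]]]] :=
    filter_ex (filterI UC (filterI (pU _ r20) (Ep _ r20))).
  exfalso; apply: nC => x Ex; apply: contrapT => noy.
  have zy : eucl_dist (z n) y < r.
    by have := eucl_distD p (z n) y; rewrite (eucl_distC (z n) p);
      move: pz => /= pz; lra.
  suff : r <= eucl_dist (z n) y by rewrite leNgt zy.
  apply: (zP n).2 => //; exists x => // y' Sy'; rewrite leNgt.
  apply/negP => xy'.
  by apply: noy; exists y'.
have /choice[phi phiP] : forall k, exists n, [/\ (k <= n)%N,
    forall x, E x -> exists2 y, S n y & eucl_dist x y < k.+1%:R^-1 &
    forall y, S n y -> exists2 x, E x & eucl_dist x y < k.+1%:R^-1].
  move=> k; have k0 : 0 < k.+1%:R^-1 :> R by rewrite invr_gt0.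
  have Uk : U [set n | (k <= n)%N] by apply: Uoo; exists k.
  have [n [kn [nE nS]]] := filter_ex (filterI Uk (filterI (ES _ k0) (SE _ k0))).
  by exists n.
by exists E, phi; split => //; exists x0.
Qed.

End Golab.

(** * Enlarging a continuum to a prescribed length *)

Section Stars.
Variable R : realType.
Implicit Types (x y : 'rV[R]_2) (E K : set 'rV[R]_2) (N j n : nat)
  (r s t L : R).

(** The ray of slope [j / N] issued from [x], parametrized by the abscissa
    relative to [x]. *)
Definition spoke x N j s : 'rV[R]_2 :=
  x + s *: \row_i (if i == 0 then 1 else j%:R / N%:R).

Definition star x N t := \bigcup_(j < N) (spoke x N j @` `[0, t]).

Lemma spoke0 x N j : spoke x N j 0 = x.
Proof. by rewrite /spoke scale0r addr0. Qed.

Lemma spoke_coord0 x N j s : spoke x N j s 0 0 = x 0 0 + s.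
Proof. by rewrite !mxE eqxx mulr1. Qed.

Lemma spoke_coord1 x N j s : spoke x N j s 0 1 = x 0 1 + s * (j%:R / N%:R).
Proof. by rewrite !mxE. Qed.

Lemma spoke_lipschitz x N j s t : (j < N)%N ->
  eucl_dist (spoke x N j s) (spoke x N j t) <= 2 * `|s - t|.
Proof.
move=> jN; apply: le_trans (eucl_dist_le_coords _ _) _.
rewrite !spoke_coord0 !spoke_coord1.
have -> : x 0 0 + s - (x 0 0 + t) = s - t by ring.
have -> : x 0 1 + s * (j%:R / N%:R) - (x 0 1 + t * (j%:R / N%:R)) =
  (s - t) * (j%:R / N%:R) by ring.
have N0 : 0 < N%:R :> R by rewrite ltr0n (leq_ltn_trans _ jN).
have q0 : 0 <= j%:R / N%:R :> R by rewrite divr_ge0.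
have q1 : j%:R / N%:R <= 1 :> R.
  by rewrite ler_pdivrMr// mul1r ler_nat ltnW.
rewrite normrM (ger0_norm q0).
have := ler_wpM2l (normr_ge0 (s - t)) q1; lra.
Qed.

Lemma spoke_continuous x N j : continuous (spoke x N j).
Proof.
move=> s; apply: cvgD; first exact: cvg_cst.
exact: scalel_continuous.
Qed.

Lemma star_closed x N t : closed (star x N t).
Proof.
apply: closed_bigcup; first exact: finite_II.
move=> j _; apply: compact_closed; first exact: norm_hausdorff.
apply: continuous_compact; last exact: segment_compact.
exact/continuous_subspaceT/spoke_continuous.
Qed.

Lemma star_connected x N t : 0 <= t -> connected (star x N t).
Proof.
move=> t0; apply: bigcup_connected.
  exists x => j _; exists 0; last exact: spoke0.
  by rewrite /= in_itv/= lexx t0.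
move=> j _; apply: connected_continuous_connected.
  exact: segment_connected.
exact/continuous_subspaceT/spoke_continuous.
Qed.

Lemma star_near x N t y : star x N t y -> eucl_dist x y <= 2 * t.
Proof.
move=> [j jN [s]]; rewrite /= in_itv/= => /andP[s0 st] <-.
have := spoke_lipschitz x 0 s jN; rewrite spoke0 => /le_trans; apply.
by rewrite sub0r normrN ger0_norm// ler_wpM2l.
Qed.

Lemma subset_star x N s t : s <= t -> star x N s `<=` star x N t.
Proof.
move=> st y [j jN [u]]; rewrite /= in_itv/= => /andP[u0 us] <-.
by exists j => //; exists u => //; rewrite /= in_itv/= u0 (le_trans us).
Qed.

Lemma star_le0 x N t : t <= 0 -> star x N t `<=` [set x].
Proof.
move=> t0 y [j jN [s]]; rewrite /= in_itv/= => /andP[s0 st] <-.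
suff -> : s = 0 by rewrite spoke0.
by apply/eqP; rewrite eq_le s0 (le_trans st).
Qed.

(** When the parameter grows from [s] to [t], each of the [N] spokes grows by a
    segment of length at most [2 * (t - s)]. *)
Lemma hausdorff1_star_growth E x N s t : s <= t ->
  (hausdorff1 (E `|` star x N t) <=
   hausdorff1 (E `|` star x N s) + (N%:R * (2 * (t - s)))%:E)%E.
Proof.
move=> st; pose G n := [set y | exists2 j, (j < n)%N &
  (spoke x N j @` `[s, t]) y].
have step n : (n <= N)%N -> (hausdorff1 ((E `|` star x N s) `|` G n) <=
    hausdorff1 (E `|` star x N s) + (n%:R * (2 * (t - s)))%:E)%E.
  elim: n => [_|n IHn nN].
    rewrite mul0r adde0; apply: le_hausdorff1.
    by move=> y [//|[]].
  rewrite -natr1 mulrDl mul1r EFinD addeA.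
  apply: le_trans (leeD2r _ (IHn (ltnW nN))).
  apply: le_trans (hausdorff1_setU_lipschitz _ (g := spoke x N n) _ st _) => //.
    apply: le_hausdorff1 => y [Ey|[j]]; first by left; left.
    rewrite ltnS leq_eqVlt => /orP[/eqP-> jy|jn jy]; first by right.
    by left; right; exists j.
  by move=> u v _ _; exact: spoke_lipschitz.
apply: le_trans (step N (leqnn N)); apply: le_hausdorff1.
move=> y [Ey|[j jN [u]]]; first by left; left.
rewrite /= in_itv/= => /andP[u0 ut] <-.
have [us|su] := leP u s.
  by left; right; exists j => //; exists u => //; rewrite /= in_itv/= u0.
by right; exists j => //; exists u => //; rewrite /= in_itv/= ltW.
Qed.

(** The outer halves [E] of the spokes are separated from each other. On the
    [j]-th spoke [f] is the abscissa shifted by [j * (r / 2)], where [j] is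
    recovered from the slope, so that [f] is locally nonexpanding and lays the
    [N] halves end to end. *)
Lemma hausdorff1_star_ge x N r : (0 < N)%N -> 0 < r ->
  ((N%:R * (r / 2))%:E <= hausdorff1 (star x N r))%E.
Proof.
move=> N0 r0; have NR0 : 0 < N%:R :> R by rewrite ltr0n.
pose E := [set y | exists j u,
  [/\ (j < N)%N, r / 2 <= u <= r & y = spoke x N j u]].
apply: (@le_trans _ _ (hausdorff1 E)); last first.
  apply: le_hausdorff1 => _ [j [u [jN /andP[ru ur] ->]]].
  by exists j => //; exists u => //; rewrite /= in_itv/= ur andbT; lra.
pose f (y : 'rV[R]_2) := (y 0 0 - x 0 0) +
  (r / 2) * (N%:R * ((y 0 1 - x 0 1) / (y 0 0 - x 0 0))).
have fE j u : r / 2 <= u -> f (spoke x N j u) = u + (r / 2) * j%:R.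
  move=> ru; have u0 : 0 < u by lra.
  rewrite /f spoke_coord0 spoke_coord1 !(addrC (x 0 _)) !addrK.
  congr (_ + _ * _).
  by field; rewrite !gt_eqF.
have -> : N%:R * (r / 2) = (r / 2 + N%:R * (r / 2)) - r / 2 by ring.
apply: (@hausdorff1_ge_length _ E f (r / (16 * N%:R))).
- by rewrite divr_gt0// mulr_gt0.
- move=> _ _ [j [u [jN /andP[ru ur] ->]]] [k [v [kN /andP[rv vr] ->]]].
  set p := spoke x N j u; set q := spoke x N k v => pq.
  have c0 := coord_le_eucl_dist 0 p q; have c1 := coord_le_eucl_dist 1 p q.
  rewrite /p /q !spoke_coord0 !spoke_coord1 -/p -/q in c0 c1.
  have [jk|jk] := eqVneq j k.
    rewrite !fE// jk; apply: le_trans c0.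
    by rewrite le_eqVlt; apply/orP; left; apply/eqP; congr (`|_|); ring.
  exfalso.
  have c0' : `|u - v| <= r / (16 * N%:R).
    by apply: le_trans pq; apply: le_trans c0; rewrite le_eqVlt;
      apply/orP; left; apply/eqP; congr (`|_|); ring.
  have c1' : `|u * j%:R - v * k%:R| <= r / 16.
    have -> : u * j%:R - v * k%:R = N%:R * (x 0 1 + u * (j%:R / N%:R) -
      (x 0 1 + v * (k%:R / N%:R))) by field; rewrite gt_eqF.
    rewrite normrM (ger0_norm (ltW NR0)).
    have := ler_wpM2l (ltW NR0) (le_trans c1 pq).
    by have -> : N%:R * (r / (16 * N%:R)) = r / 16 by field; rewrite gt_eqF.
  have c0'' : `|(u - v) * k%:R| <= r / 16.
    rewrite normrM (ger0_norm (ler0n _ _)).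
    apply: (@le_trans _ _ (r / (16 * N%:R) * N%:R)).
      by apply: ler_pM => //; rewrite ler_nat ltnW.
    by have -> : r / (16 * N%:R) * N%:R = r / 16 by field; rewrite gt_eqF.
  (* Points of different spokes have slopes at least [1 / N] apart and abscissas
     at least [r / 2], so they cannot be [r / (16 * N)]-close. *)
  have jk1 : 1 <= `|j%:R - k%:R : R|.
    have [jk'|kj|jk'] := ltngtP j k; last by rewrite jk' eqxx in jk.
      rewrite distrC ger0_norm ?subr_ge0 ?ler_nat ?(ltnW jk')//.
      by rewrite lerBrDl natr1 ler_nat.
    rewrite ger0_norm ?subr_ge0 ?ler_nat ?(ltnW kj)//.
    by rewrite lerBrDl natr1 ler_nat.
  have : u <= `|u * (j%:R - k%:R)|.
    rewrite normrM ger0_norm; last by lra.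
    by rewrite ler_peMr//; lra.
  have -> : u * (j%:R - k%:R) = (u * j%:R - v * k%:R) - (u - v) * k%:R by ring.
  have := ler_normB (u * j%:R - v * k%:R) ((u - v) * k%:R); lra.
- move=> t; rewrite /= in_itv/= => /andP[tl tu].
  have [||j jN /andP[jl ju]] := @grid_cell _ N (r / 2) (t - r / 2) N0 _ _.
  + by rewrite divr_ge0// ltW.
  + by apply/andP; split; lra.
  rewrite -[j.+1%:R]natr1 mulrDl mul1r in ju.
  have ru : r / 2 <= t - j%:R * (r / 2) by lra.
  exists (spoke x N j (t - j%:R * (r / 2))).
    by exists j, (t - j%:R * (r / 2)); split=> //; rewrite ru/=; lra.
  by rewrite fE//; ring.
Qed.

(** The length of [E] together with a star at [x] is a Lipschitz function of
    the radius of the star. It starts from at most [L] and, with enough spokes,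
    ends at least at [L], however small the ball available around [x]. *)
Lemma enlarge_to_length E K x e L : closed E -> connected E -> E `<=` K ->
  E x -> 0 < e -> ball x e `<=` K -> (hausdorff1 E <= L%:E)%E ->
  exists S,
    [/\ E `<=` S, S `<=` K, closed S, connected S & hausdorff1 S = L%:E].
Proof.
move=> Ecl Econn EK Ex e0 xK EL.
pose r := e / 3.
have r0 : 0 < r by rewrite divr_gt0.
have r20 : 0 < r / 2 by rewrite divr_gt0.
have L0 : 0 <= L by rewrite -lee_fin (le_trans (hausdorff1_ge0 E)).
have [N N0 LN] : exists2 N, (0 < N)%N & L <= N%:R * (r / 2).
  exists (Num.bound (L / (r / 2))).+1 => //.
  rewrite -ler_pdivrMr// ltW//.
  apply: lt_le_trans (archi_boundP _) _; first by rewrite divr_ge0// ltW.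
  by rewrite ler_nat.
pose S t := E `|` star x N t.
have Sfin t : hausdorff1 (S t) \is a fin_num.
  rewrite ge0_fin_numE ?hausdorff1_ge0//.
  have mt : Num.min 0 t <= t by rewrite ge_min lexx orbT.
  apply: le_lt_trans (hausdorff1_star_growth E x N mt) _.
  apply: lte_add_pinfty; last exact: ltry.
  apply: le_lt_trans (ltry L); apply: le_trans EL; apply: le_hausdorff1.
  move=> y [//|/star_le0 H]; rewrite (H _)//.
  by rewrite ge_min lexx.
pose g t := fine (hausdorff1 (S t)).
have gE t : hausdorff1 (S t) = (g t)%:E by rewrite fineK.
pose c := N%:R * 2 + 1 : R.
have c0 : 0 < c by rewrite addr_gt0// mulr_gt0// ltr0n.
have glip s t : s <= t -> g s <= g t <= g s + c * (t - s).
  move=> st; rewrite -2!lee_fin -gE EFinD -!gE; apply/andP; split.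
    by apply: le_hausdorff1; apply: setUS; exact: subset_star.
  apply: le_trans (hausdorff1_star_growth E x N st) _.
  by rewrite leeD2l// lee_fin /c; lra.
have gcont : continuous g.
  move=> t; apply/cvgrPdist_lt => eps eps0; near=> s.
  have : `|t - s| < eps / c.
    by near: s; apply: cvgr_dist_lt => //; rewrite divr_gt0.
  rewrite ltr_pdivlMr// mulrC; apply: le_lt_trans.
  have [st|ts] := leP s t.
    have /andP[g1 g2] := glip s t st.
    by rewrite !ger0_norm ?subr_ge0//; lra.
  have /andP[g1 g2] := glip t s (ltW ts).
  by rewrite distrC (distrC t s) !ger0_norm ?subr_ge0 ?(ltW ts)//; lra.
have g0L : g 0 <= L.
  rewrite -lee_fin -gE; apply: le_trans EL; apply: le_hausdorff1.
  by move=> y [//|/star_le0 H]; rewrite (H _).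
have Lgr : L <= g r.
  rewrite -lee_fin -gE; apply: (@le_trans _ _ (N%:R * (r / 2))%:E).
    by rewrite lee_fin.
  apply: le_trans (hausdorff1_star_ge x N0 r0) _; apply: le_hausdorff1.
  exact: subsetUr.
have [|t] := IVT (ltW r0) (continuous_subspaceT gcont) (v := L).
  by rewrite ge_min le_max g0L Lgr orbT.
rewrite in_itv/= => /andP[t0 tr] gt.
exists (S t); split.
- exact: subsetUl.
- move=> y [/EK//|/star_near xy]; apply/xK/ball_eucl_dist.
  by apply: le_lt_trans xy _; move: tr; rewrite /r; lra.
- by apply: closedU => //; exact: star_closed.
- apply: connectedU => //; last exact: star_connected.
  exists x; split=> //; exists 0%N => //; exists 0; last exact: spoke0.
  by rewrite /= in_itv/= lexx t0.
- by rewrite gE gt.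
Unshelve. all: by end_near. Qed.

End Stars.

(** * The direct method *)

Section DirectMethod.
Variable R : realType.
Implicit Types (A B E S Omega : set 'rV[R]_2) (r L : R).

(** Nonemptiness matters for the lower bound only: a supremum over the empty
    set is [-oo]. *)
Lemma hausdorff_dist_le A B r : A !=set0 ->
  (forall x, A x -> exists2 y, B y & eucl_dist x y <= r) ->
  (forall y, B y -> exists2 x, A x & eucl_dist x y <= r) ->
  (0 <= hausdorff_dist A B <= r%:E)%E.
Proof.
move=> [a Aa] AB BA; apply/andP; split.
  rewrite /hausdorff_dist le_max; apply/orP; left.
  apply: le_ereal_sup_tmp; exists (dist_to_set a B); first by exists a.
  by apply/ereal_infP => _ [y _ <-]; rewrite lee_fin eucl_dist_ge0.
rewrite /hausdorff_dist ge_max; apply/andP; split.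
  apply/ereal_supP => _ [x /AB[y By xy] <-].
  by apply: ge_ereal_inf; exists (eucl_dist x y)%:E => //; exists y.
apply/ereal_supP => _ [y /BA[x Ax xy] <-].
apply: ge_ereal_inf; exists (eucl_dist y x)%:E; first by exists x.
by rewrite lee_fin eucl_distC.
Qed.

(** All these complements share the part [closure Omega `\` Omega], so their
    Hausdorff distances are controlled by those of the removed sets. *)
Lemma setD_closure_setD Omega S : S `<=` closure Omega ->
  closure Omega `\` (Omega `\` S) = (closure Omega `\` Omega) `|` S.
Proof.
move=> SO; apply/seteqP; split=> x.
  move=> [Kx nOS]; have [Sx|nSx] := pselect (S x); first by right.
  by left; split=> // Ox; apply: nOS.
by move=> [[Kx nOx]|Sx]; split=> //; [case|exact: SO|case].
Qed.

Lemma hausdorff_converging_setD Omega E (S : nat -> set 'rV[R]_2) :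
  E `<=` closure Omega -> (forall k, S k `<=` closure Omega) -> E !=set0 ->
  (forall k x, E x -> exists2 y, S k y & eucl_dist x y < k.+1%:R^-1) ->
  (forall k y, S k y -> exists2 x, E x & eucl_dist x y < k.+1%:R^-1) ->
  hausdorff_converging Omega (fun k => Omega `\` S k) (Omega `\` E).
Proof.
move=> EK SK [x0 Ex0] ES SE; rewrite /hausdorff_converging setD_closure_setD//.
have bound k : (0 <= hausdorff_dist (closure Omega `\` (Omega `\` S k))
    ((closure Omega `\` Omega) `|` E) <= (k.+1%:R^-1)%:E)%E.
  rewrite setD_closure_setD//; apply: hausdorff_dist_le.
  - by have [y Sy _] := ES k x0 Ex0; exists y; right.
  - move=> y [bdy|/(SE k)[x Ex xy]].
      by exists y; [left|rewrite eucl_distxx].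
    by exists x; [right|rewrite eucl_distC ltW].
  - move=> y [bdy|/(ES k)[x Sx xy]].
      by exists y; [left|rewrite eucl_distxx].
    by exists x; [right|rewrite eucl_distC ltW].
apply: (@squeeze_cvge _ _ _ _ (fun=> 0%E) _ (fun k => (k.+1%:R^-1)%:E)).
- by apply: nearW => k; exact: bound.
- exact: cvg_cst.
- by apply/fine_cvgP; split; [exact: nearW|exact: cvg_harmonic].
Qed.

Lemma bounded_closure_compact Omega :
  bounded_set Omega -> compact (closure Omega).
Proof.
move=> bO; apply: bounded_closed_compact; last exact: closed_closure.
have [M [Mreal OM]] := bO; exists M; split=> // N MN x clx /=.
rewrite leNgt; apply/negP => Nx.
have e0 : 0 < `|x| - N by rewrite subr_gt0.
have [y [Oy]] := clx _ (nbhsx_ballx x _ e0).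
rewrite -ball_normE /= => xy.
have := OM N MN y Oy; have := ler_normD (x - y) y; rewrite subrK /=; lra.
Qed.

Lemma hausdorff1_set0 : hausdorff1 (set0 : set 'rV[R]_2) = 0%E.
Proof.
apply/eqP; rewrite eq_le hausdorff1_ge0 andbT.
by apply/ereal_supP => _ [d /= /ltW d0 <-]; rewrite hausdorff1_delta_set0.
Qed.

Lemma hausdorff1_set1 (x : 'rV[R]_2) : hausdorff1 [set x] = 0%E.
Proof.
apply/eqP; rewrite eq_le hausdorff1_ge0 andbT.
apply/ereal_supP => _ [d /= d0 <-].
rewrite -[[set x]]set0U -[leRHS]adde0 -{1}(hausdorff1_delta_set0 (ltW d0)).
apply: hausdorff1_delta_setU1; first by rewrite lexx ltW.
by move=> _ _ -> ->; rewrite eucl_distxx.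
Qed.

Lemma admissible_neq0 Omega L S : 0 < L -> admissible Omega L S -> S !=set0.
Proof.
move=> L0 [_ _ _ SL]; apply/set0P/eqP => S0.
by move: SL; rewrite S0 hausdorff1_set0 => -[] /eqP; rewrite lt_eqF.
Qed.

Lemma open_subsetsD Omega S : open Omega -> closed S ->
  open_subsets Omega (Omega `\` S).
Proof.
move=> Oo Scl; split; last exact: subDsetl.
by apply: openI => //; exact: closed_openC.
Qed.

Lemma enlarge_to_admissible Omega L E x : open Omega ->
  closed E -> connected E -> E `<=` closure Omega ->
  E x -> Omega x -> (hausdorff1 E <= L%:E)%E ->
  exists2 S, admissible Omega L S & E `<=` S.
Proof.
move=> Oo Ecl Econn EK Ex Ox EL.
have [e /= e0 eO] : nbhs_ball x Omega by rewrite nbhs_ballE; exact: Oo.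
have [S [ES SK Scl Sconn SL]] := enlarge_to_length Ecl Econn EK Ex e0
  (subset_trans eO (@subset_closure _ _)) EL.
by exists S.
Qed.

(** Compactness of the class of admissible sets, up to a possible loss of
    length. *)
Lemma admissible_limit Omega L (S : nat -> set 'rV[R]_2) :
  bounded_set Omega -> 0 < L -> (forall n, admissible Omega L (S n)) ->
  exists E (phi : nat -> nat),
  [/\ E `<=` closure Omega, closed E, connected E, (hausdorff1 E <= L%:E)%E &
   (forall k, (k <= phi k)%N) /\
   hausdorff_converging Omega (fun k => Omega `\` S (phi k)) (Omega `\` E)].
Proof.
move=> bO L0 Sadm; have Kcpt := bounded_closure_compact bO.
have [|n|E [phi [Ecl EK E0 phiP]]] := blaschke_selection (S := S) Kcpt.
- by move=> n; have [] := Sadm n.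
- exact: admissible_neq0 (Sadm n).
have small (rho : R) : 0 < rho -> exists k : nat, k.+1%:R^-1 <= rho.
  move=> rho0; exists (Num.bound rho^-1).
  rewrite -[leRHS]invrK lef_pV2 ?posrE ?invr_gt0//.
  apply: le_trans (ltW (archi_boundP _)) _; first by rewrite invr_ge0 ltW.
  by rewrite ler_nat.
exists E, phi; split => //.
- apply: connected_of_approx; first exact: subclosed_compact Ecl Kcpt EK.
  move=> rho /small[k krho]; have [_ ES SE] := phiP k.
  exists (S (phi k)); split; first by have [] := Sadm (phi k).
  + by move=> x /ES[y Sy xy]; exists y => //; apply: le_trans (ltW xy) krho.
  + by move=> y /SE[x Ex xy]; exists x => //; apply: le_trans (ltW xy) krho.
- apply: golab_hausdorff1_le; first exact: ltW.
  move=> rho /small[k krho]; have [_ ES _] := phiP k.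
  have [SK Scl Sconn SL] := Sadm (phi k).
  exists (S (phi k)); split => //.
  + exact: subclosed_compact Scl Kcpt SK.
  + by rewrite SL.
  + by move=> x /ES[y Sy xy]; exists y => //; apply: le_trans (ltW xy) krho.
- split; first by move=> k; have [] := phiP k.
  apply: hausdorff_converging_setD => //.
  + by move=> k; have [] := Sadm (phi k).
  + by move=> k; have [] := phiP k.
  + by move=> k; have [] := phiP k.
Qed.

End DirectMethod.

Theorem theorem1p1 (R : realType) (Omega : set 'rV[R]_2) (L : R)
    (F : set 'rV[R]_2 -> \bar R) :
  open Omega -> bounded_set Omega -> connected Omega -> Omega !=set0 ->
  0 < L ->
  (forall A : set 'rV[R]_2, open_subsets Omega A -> (0 <= F A)%E) ->
  hausdorff_lsc Omega F ->
  set_monotone Omega F ->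
  exists2 Sigma : set 'rV[R]_2, admissible Omega L Sigma &
    forall Sigma1 : set 'rV[R]_2, admissible Omega L Sigma1 ->
      (F (Omega `\` Sigma) <= F (Omega `\` Sigma1))%E.
Proof.
move=> Oo bO _ [x0 Ox0] L0 _ Flsc Fmono.
have [S0 S0adm x0S0] : exists2 S, admissible Omega L S & [set x0] `<=` S.
  apply: (enlarge_to_admissible Oo _ _ _ (erefl x0) Ox0).
  - apply: compact_closed; [exact: norm_hausdorff|exact: compact_set1].
  - exact: connected1.
  - by move=> _ ->; exact: subset_closure.
  - by rewrite hausdorff1_set1 lee_fin ltW.
pose values := [set F (Omega `\` S) | S in admissible Omega L].
have [|u uval ucvg] := ereal_inf_seq (S := values).
  by apply/set0P; exists (F (Omega `\` S0)); exists S0.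
have /choice[S SP] : forall n, exists S, admissible Omega L S /\
    F (Omega `\` S) = u n by move=> n; have [S Sadm FS] := uval n; exists S.
have Sadm n : admissible Omega L (S n) by have [] := SP n.
have [E [phi [EK Ecl Econn EL [phi_ge Ecvg]]]] := admissible_limit bO L0 Sadm.
have FE : (F (Omega `\` E) <= ereal_inf values)%E.
  have -> : ereal_inf values = limn_einf (fun k => F (Omega `\` S (phi k))).
    have uphi : F (Omega `\` S (phi k)) @[k --> \oo] --> ereal_inf values.
      under eq_fun do rewrite (SP _).2.
      apply: cvg_comp ucvg => B [n _ nB]; exists n => // k nk.
      exact/nB/(leq_trans nk)/phi_ge.
    by rewrite is_cvg_limn_einfE; [exact/esym/cvg_lim|exact: cvgP uphi].
  apply: Flsc => //; last exact: open_subsetsD.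
  by move=> k; have [_ Scl _ _] := Sadm (phi k); exact: open_subsetsD.
suff [T Tadm FT] : exists2 T, admissible Omega L T &
    (F (Omega `\` T) <= F (Omega `\` E))%E.
  exists T => // S1 S1adm; apply: le_trans FT (le_trans FE _).
  by apply: ereal_inf_lbound; exists S1.
(* The length lost in the limit is recovered by enlarging [E] inside [Omega]. *)
have [[x [Ex Ox]]|EO] := pselect (E `&` Omega !=set0).
  have [T Tadm ET] := enlarge_to_admissible Oo Ecl Econn EK Ex Ox EL.
  exists T => //; have [_ Tcl _ _] := Tadm.
  by apply: Fmono; [exact: open_subsetsD|exact: open_subsetsD|exact: setDS].
(* Here [Omega `\` E] is [Omega]. *)
exists S0 => //; have [_ S0cl _ _] := S0adm.
apply: Fmono; [exact: open_subsetsD|exact: open_subsetsD|].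
by move=> x [Ox _]; split=> // Ex; apply: EO; exists x.
Qed.
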